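(* Let $\mu_t=\frac1N\sum_{i=1}^N\delta_{z_i}$ (with $N\ge 2$) and $\mu_v=\frac1{N'}\sum_{j=1}^{N'}\delta_{z'_j}$ be the empirical measures of a labeled training set $\mathbb{D}_t=\{z_i\}_{i=1}^N$ and a labeled validation set $\mathbb{D}_v=\{z'_j\}_{j=1}^{N'}$, let $C\in\mathbb{R}_+^{N\times N'}$ be the feature-label cost matrix, and let $\varepsilon>0$. Let $(h^*,f^*,g^* )$ be optimal dual variables of the optimal transport problem between $\mu_t$ and $\mu_v$ with cost $C$, let $\pi_\varepsilon^*$ be the optimal plan of the entropic regularized problem, and let $(f_\varepsilon^*,g_\varepsilon^* )$ be optimal dual variables of the entropic regularized problem. Then for any two indices $i,k\in\{1,\dots,N\}$ with $i\ne k$ and any $j\in\{1,\dots,N'\}$, the difference between the calibrated gradients of the two data points $z_i,z_k\in\mathbb{D}_t$ satisfies $$\frac{\partial\,\mathrm{OT}(\mu_t,\mu_v)}{\partial\mu_t(z_i)}-\frac{\partial\,\mathrm{OT}(\mu_t,\mu_v)}{\partial\mu_t(z_k)}=\frac{\partial\,\mathrm{OT}_\varepsilon(\mu_t,\mu_v)}{\partial\mu_t(z_i)}-\frac{\partial\,\mathrm{OT}_\varepsilon(\mu_t,\mu_v)}{\partial\mu_t(z_k)}+\varepsilon\,\frac{N}{N-1}\left(\log\frac{(\pi_\varepsilon^* )_{ij}/\mu_t(z_i)}{(\pi_\varepsilon^* )_{kj}/\mu_t(z_k)}+\frac{h^*_{kj}-h^*_{ij}}{\varepsilon}\right),$$ where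 $h^*$ is the optimal dual variable accounting for the non-negativity constraint $\pi\ge 0$ on the transportation plan in the primal optimal transport problem.
   Context: Labeled data points are pairs $z=(x,y)$ with feature $x$ in a metric space $(\mathcal{X},\mathrm{d})$ and label $y$ in a finite label set. Points are indexed, with masses $\mu_t(z_i)=1/N$ and $\mu_v(z'_j)=1/N'$. Cost. For a label $y$, $\mu_t(\cdot\mid y)$ (resp. $\mu_v(\cdot\mid y)$) is the uniform empirical measure on the features of the points of $\mathbb{D}_t$ (resp. $\mathbb{D}_v$) carrying label $y$. For a fixed constant $c>0$, the cost between $z_i=(x_i,y_i)$ and $z'_j=(x'_j,y'_j)$ is $C_{ij}=\mathrm{d}(x_i,x'_j)+c\,\mathrm{OT}_{\mathrm{d}}(\mu_t(\cdot\mid y_i),\mu_v(\cdot\mid y'_j))$, where $\mathrm{OT}_{\mathrm{d}}$ is the optimal transport distance with ground cost $\mathrm{d}$. Optimal transport. $\Pi(\mu_t,\mu_v)$ is the set of $\pi\in\mathbb{R}_{+}^{N\times N'}$ with row sums $\mu_t(z_i)$ and column sums $\mu_v(z'_j)$. Define $\mathrm{OT}(\mu_t,\mu_v)=\min_{\pi\in\Pi(\mu_t,\mu_v)}\langle\pi,C\rangle$ and $$\mathrm{OT}_\varepsilon(\mu_t,\mu_v)=\min_{\pi\in\Pi(\mu_t,\mu_v)}\langle\pi,C\rangle+\varepsilon\sum_{i,j}\pi_{ij}\log\frac{\pi_{ij}}{\mu_t(z_i)\mu_v(z'_j)}\qquad(0\log 0=0),$$ with minimizer $\pi^*_\varepsilon$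 of the latter. Dual variables (sign convention). The Lagrangian of $\mathrm{OT}$ is, for $\pi\in\mathbb{R}^{N\times N'}$, $h\in\mathbb{R}^{N\times N'}$ with $h\le 0$ entrywise, $f\in\mathbb{R}^N$, $g\in\mathbb{R}^{N'}$, $$\mathcal{L}(\pi,h,f,g)=\langle\pi,C\rangle+\langle h,\pi\rangle+\sum_{i}f_i\Big(\sum_j\pi_{ij}-\mu_t(z_i)\Big)+\sum_j g_j\Big(\sum_i\pi_{ij}-\mu_v(z'_j)\Big),$$ and $(h^*,f^*,g^* )$ is any maximizer of $\inf_{\pi}\mathcal{L}(\pi,h,f,g)$. The Lagrangian of $\mathrm{OT}_\varepsilon$ is, for $\pi\ge0$, $$\mathcal{L}_\varepsilon(\pi,f,g)=\langle\pi,C\rangle+\varepsilon\sum_{i,j}\pi_{ij}\log\frac{\pi_{ij}}{\mu_t(z_i)\mu_v(z'_j)}+\sum_{i}f_i\Big(\sum_j\pi_{ij}-\mu_t(z_i)\Big)+\sum_j g_j\Big(\sum_i\pi_{ij}-\mu_v(z'_j)\Big),$$ and $(f^*_\varepsilon,g^*_\varepsilon)$ is any maximizer of $\inf_{\pi\ge0}\mathcal{L}_\varepsilon(\pi,f,g)$. Calibrated gradients. These are defined by $$\frac{\partial\,\mathrm{OT}(\mu_t,\mu_v)}{\partial\mu_t(z_i)}:=f^*_i-\sum_{m\ne i}\frac{f^*_m}{N-1},\qquad \frac{\partial\,\mathrm{OT}_\varepsilon(\mu_t,\mu_v)}{\partial\mu_t(z_i)}:=(f^*_\varepsilon)_i-\sum_{m\ne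 i}\frac{(f^*_\varepsilon)_m}{N-1},$$ using the $f^*$, $f_\varepsilon^*$ above (the same $f^*$ that accompanies $h^*$). *)

(* Defs.v *)
From mathcomp Require Import all_boot all_order all_algebra.
From mathcomp Require Import all_classical all_reals all_analysis.

Set Implicit Arguments.
Unset Strict Implicit.
Unset Printing Implicit Defensive.

Import Order.TTheory GRing.Theory Num.Theory.

Local Open Scope classical_set_scope.
Local Open Scope ring_scope.

Section DiscreteOT.
Context {R : realType} {n m : nat}.
Implicit Types (a f : 'rV[R]_n) (b g : 'rV[R]_m) (C pi h : 'M[R]_(n, m)).

Definition mxdot (A B : 'M[R]_(n, m)) : R := \sum_i \sum_j A i j * B i j.

Definition mx_nonneg pi : Prop := forall i j, 0 <= pi i j.

(* A discrete measure is the row vector of the masses of its indexed points;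
   distinct indices may carry the same point. *)
Definition couplings a b : set 'M[R]_(n, m) :=
  [set pi | [/\ mx_nonneg pi,
                forall i, \sum_j pi i j = a 0 i
              & forall j, \sum_i pi i j = b 0 j]].

(* For nonnegative [a], [b] of equal total mass the set is nonempty and
   compact, so this infimum is a minimum. *)
Definition OT a b C : R := inf [set mxdot pi C | pi in couplings a b].

(* [ln 0 = 0] in the library, and in any case the factor [pi i j] enforces
   [0 log 0 = 0]. *)
Definition relative_entropy a b pi : R :=
  \sum_i \sum_j pi i j * ln (pi i j / (a 0 i * b 0 j)).

Definition entropic_cost (eps : R) a b C pi : R :=
  mxdot pi C + eps * relative_entropy a b pi.

Definition entropic_plan (eps : R) a b C pi : Prop :=
  couplings a b pi /\
  forall pi', couplings a b pi' ->
    entropic_cost eps a b C pi <= entropic_cost eps a b C pi'.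

Definition marginal_terms a b pi f g : R :=
  \sum_i f 0 i * (\sum_j pi i j - a 0 i) +
  \sum_j g 0 j * (\sum_i pi i j - b 0 j).

Definition lagrangian a b C pi h f g : R :=
  mxdot pi C + mxdot h pi + marginal_terms a b pi f g.

(* Infimum over all real matrices; it is -oo off the dual feasible set. *)
Definition dual_fun a b C h f g : \bar R :=
  ereal_inf [set (lagrangian a b C pi h f g)%:E | pi in [set: 'M[R]_(n, m)]].

Definition mx_nonpos h : Prop := forall i j, h i j <= 0.

Definition dual_optimal a b C h f g : Prop :=
  mx_nonpos h /\
  forall h' f' g', mx_nonpos h' ->
    (dual_fun a b C h' f' g' <= dual_fun a b C h f g)%E.

Definition entropic_lagrangian (eps : R) a b C pi f g : R :=
  entropic_cost eps a b C pi + marginal_terms a b pi f g.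

Definition entropic_dual_fun (eps : R) a b C f g : \bar R :=
  ereal_inf [set (entropic_lagrangian eps a b C pi f g)%:E
            | pi in [set pi | mx_nonneg pi]].

Definition entropic_dual_optimal (eps : R) a b C f g : Prop :=
  forall f' g',
    (entropic_dual_fun eps a b C f' g' <= entropic_dual_fun eps a b C f g)%E.

End DiscreteOT.

Section LabeledData.
Context {R : realType}.

Definition empirical_mass (n : nat) : 'rV[R]_n := const_mx (n%:R^-1).

Definition label_mass (n : nat) (X : Type) (Y : finType) (z : 'I_n -> X * Y)
    (y : Y) : 'rV[R]_n :=
  \row_i (if (z i).2 == y then (#|[set k | (z k).2 == y]%SET|%:R)^-1 else 0).

Definition feature_dist (X : metricType R) (Y : finType) (n m : nat)
    (z : 'I_n -> X * Y) (z' : 'I_m -> X * Y) : 'M[R]_(n, m) :=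
  \matrix_(i, j) mdist (z i).1 (z' j).1.

Definition label_dist (X : metricType R) (Y : finType) (n m : nat)
    (z : 'I_n -> X * Y) (z' : 'I_m -> X * Y) (y y' : Y) : R :=
  OT (label_mass z y) (label_mass z' y') (feature_dist z z').

Definition feature_label_cost (X : metricType R) (Y : finType) (n m : nat)
    (c : R) (z : 'I_n -> X * Y) (z' : 'I_m -> X * Y) : 'M[R]_(n, m) :=
  \matrix_(i, j) (mdist (z i).1 (z' j).1
                  + c * label_dist z z' (z i).2 (z' j).2).

(* The calibrated gradient of OT or OT_eps, as a function of an optimal
   potential for the training marginal. *)
Definition calibrated_grad (n : nat) (f : 'rV[R]_n) (i : 'I_n) : R :=
  f 0 i - \sum_(l < n | l != i) f 0 l / (n%:R - 1).

End LabeledData.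

(* Main.v *)
(* For fixed potentials the entropic Lagrangian is separable in the entries of
   [pi], and by [ln u <= u - 1] its minimizer is the Gibbs plan
   [a_i b_j exp (- (C_ij + f_i + g_j) / eps - 1)].  At optimal potentials a
   Sinkhorn step cannot increase the dual value, so this plan is a coupling, and
   strictness in [ln u <= u - 1] makes it the optimal one.  Taking logarithms
   determines [fe_i - fe_k].  In the unregularized problem the Lagrangian is
   affine in [pi] and bounded below at a dual optimum, so its slope
   [C + h + f + g] vanishes, which determines [fs_i - fs_k]. *)
Require Import Defs.
From mathcomp Require Import all_boot all_order all_algebra.
From mathcomp Require Import all_classical all_reals all_analysis.
From mathcomp Require Import ring lra.

Set Implicit Arguments.
Unset Strict Implicit.
Unset Printing Implicit Defensive.

Import Order.TTheory GRing.Theory Num.Theory.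
Local Open Scope ring_scope.

(** This is [ln u <= u - 1] at [u = y / x], scaled by [x]. The equality case is kept because it
    later yields uniqueness of minimizers and exact marginals. *)
Lemma ln_tangent_leif (R : realType) (x y : R) : 0 < x -> 0 < y ->
  x * (1 + ln (y / x)) <= y ?= iff (x == y).
Proof.
move=> x0 y0; have u0 : 0 < y / x by rewrite divr_gt0.
apply/leifP; case: eqVneq => [<-|xy].
  by rewrite divff ?lt0r_neq0// ln1 addr0 mulr1.
rewrite mulrC -ltr_pdivlMr// -[ltRHS]lnK ?posrE//.
apply: expR_gt1Dx; apply: contra xy => /eqP l0.
have : expR (ln (y / x)) = 1 by rewrite l0 expR0.
rewrite lnK ?posrE// => /divr1_eq ->; exact: eqxx.
Qed.

Section Duality.
Context {R : realType}.

Definition gibbs_plan {n m} (eps : R) (a f : 'rV[R]_n) (b g : 'rV[R]_m)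
    (C : 'M[R]_(n, m)) : 'M[R]_(n, m) :=
  \matrix_(i, j) (a 0 i * b 0 j * expR (- (C i j + f 0 i + g 0 j) / eps - 1)).

(** Value of the entropic Lagrangian at the Gibbs plan: there the logarithm cancels the linear cost
    up to [- eps] per unit of mass. *)
Definition gibbs_value {n m} (eps : R) (a f : 'rV[R]_n) (b g : 'rV[R]_m)
    (C : 'M[R]_(n, m)) : R :=
  - (\sum_i f 0 i * a 0 i) - (\sum_j g 0 j * b 0 j)
  - eps * \sum_i \sum_j gibbs_plan eps a f b g C i j.

Lemma marginal_termsE n m (a f : 'rV[R]_n) (b g : 'rV[R]_m) (pi : 'M[R]_(n, m)) :
  marginal_terms a b pi f g =
  \sum_i \sum_j pi i j * (f 0 i + g 0 j)
  - \sum_i f 0 i * a 0 i - \sum_j g 0 j * b 0 j.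
Proof.
rewrite /marginal_terms.
under eq_bigr do rewrite mulrBr mulr_sumr.
under [X in _ + X]eq_bigr do rewrite mulrBr mulr_sumr.
rewrite !sumrB [X in _ + (X - _)]exchange_big /=.
under [in RHS]eq_bigr do (under eq_bigr do rewrite mulrDr; rewrite big_split /=).
rewrite big_split /=.
under [X in _ = X + _ - _ - _]eq_bigr do under eq_bigr do rewrite mulrC.
under [X in _ = _ + X - _ - _]eq_bigr do under eq_bigr do rewrite mulrC.
by rewrite addrACA addrA.
Qed.

Lemma marginal_terms_coupling n m (a f : 'rV[R]_n) (b g : 'rV[R]_m)
    (pi : 'M[R]_(n, m)) : couplings a b pi -> marginal_terms a b pi f g = 0.
Proof.
move=> [_ ha hb]; rewrite /marginal_terms !big1 ?addr0// => i _.
  by rewrite hb subrr mulr0.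
by rewrite ha subrr mulr0.
Qed.

Lemma lagrangianE n m (a f : 'rV[R]_n) (b g : 'rV[R]_m) (C pi h : 'M[R]_(n, m)) :
  lagrangian a b C pi h f g =
  \sum_i \sum_j pi i j * (C i j + h i j + f 0 i + g 0 j)
  - \sum_i f 0 i * a 0 i - \sum_j g 0 j * b 0 j.
Proof.
rewrite /lagrangian marginal_termsE /mxdot !addrA; congr (_ - _ - _).
rewrite -!big_split; apply: eq_bigr => i _ /=.
by rewrite -!big_split; apply: eq_bigr => j _ /=; ring.
Qed.

Lemma dual_optimal_stationary n m (a f : 'rV[R]_n) (b g : 'rV[R]_m)
    (C h : 'M[R]_(n, m)) : dual_optimal a b C h f g ->
  forall i j, C i j + h i j + f 0 i + g 0 j = 0.
Proof.
move=> [_ opt] i j; apply/eqP/negPn/negP; set M := (X in X != 0) => M0.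
(* A competitor with finite dual value is needed. For [h' = - C - K], [f' = K], [g' = 0] the slope
   [C + h' + f' + g'] vanishes, and [K] dominates every entry of [C] in absolute value, so [h'] is
   nonpositive. *)
pose K := \sum_k \sum_l `|C k l|.
have hK : mx_nonpos (\matrix_(k, l) (- C k l - K)).
  move=> k l; rewrite mxE lerBlDr add0r (le_trans (ler_norm _))// normrN.
  rewrite /K (bigD1 k)//= (bigD1 l)//= -addrA lerDl addr_ge0 ?sumr_ge0// => p _.
  exact: sumr_ge0.
have := opt _ (const_mx K) 0 hK.
set D := dual_fun _ _ _ _ _ _; set E := dual_fun _ _ _ _ _ _ => DE.
pose v := - \sum_k K * a 0 k.
have vD : (v%:E <= D)%E.
  apply: le_ereal_inf_tmp => _ [pi _ <-]; rewrite lee_fin lagrangianE.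
  rewrite big1 => [|k _]; last by rewrite big1// => l _; rewrite !mxE; ring.
  rewrite [X in _ - X]big1 => [|l _]; last by rewrite mxE mul0r.
  by rewrite subr0 add0r /v; under [X in _ <= - X]eq_bigr do rewrite mxE.
pose w := - \sum_k f 0 k * a 0 k - \sum_l g 0 l * b 0 l.
(* Along [t *: delta_mx i j] the Lagrangian is [t * M + w]. This [t] brings it to [v - 1], below the
   competitor's value [v], which contradicts optimality. *)
pose t := (v - w - 1) / M.
have : (E <= (t * M + w)%:E)%E.
  apply: ereal_inf_lbound; exists (t *: delta_mx i j) => //.
  congr EFin; rewrite lagrangianE addrA; congr (_ - _ - _).
  rewrite (bigD1 i)//= (bigD1 j)//= !mxE !eqxx mulr1.
  rewrite !big1 ?addr0// => [k ki|l lj].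
    by rewrite big1// => l _; rewrite !mxE (negbTE ki) mulr0 mul0r.
  by rewrite !mxE (negbTE lj) andbF mulr0 mul0r.
move=> /(le_trans (le_trans vD DE)); rewrite lee_fin /t divfK//; lra.
Qed.

Lemma entropic_lagrangianE n m eps (a f : 'rV[R]_n) (b g : 'rV[R]_m)
    (C pi : 'M[R]_(n, m)) :
  entropic_lagrangian eps a b C pi f g =
  \sum_i \sum_j (pi i j * (C i j + f 0 i + g 0 j)
                 + eps * (pi i j * ln (pi i j / (a 0 i * b 0 j))))
  - \sum_i f 0 i * a 0 i - \sum_j g 0 j * b 0 j.
Proof.
rewrite /entropic_lagrangian marginal_termsE /entropic_cost /mxdot
  /relative_entropy !addrA; congr (_ - _ - _).
rewrite mulr_sumr -!big_split; apply: eq_bigr => i _ /=.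
by rewrite mulr_sumr -!big_split; apply: eq_bigr => j _ /=; ring.
Qed.

(** The contribution of a single entry [p], with reference mass [w] and slope [s]: writing [q] for
    the Gibbs mass, the right side is [- eps * (p * (1 + ln (q / p)))], so the tangent inequality
    applies. *)
Lemma gibbs_pointwise_leif (eps w s p : R) : 0 < eps -> 0 < w -> 0 <= p ->
  - (eps * (w * expR (- s / eps - 1))) <= p * s + eps * (p * ln (p / w))
    ?= iff (p == w * expR (- s / eps - 1)).
Proof.
move=> e0 w0; set q := w * _; have q0 : 0 < q by rewrite mulr_gt0 ?expR_gt0.
rewrite le_eqVlt => /predU1P[<-|p0].
  rewrite !mul0r mulr0 addr0; apply/leifP.
  by rewrite lt_eqF// oppr_lt0 mulr_gt0.
have lnq : ln (q / p) = - s / eps - 1 - ln (p / w).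
  rewrite /q !ln_div ?posrE ?mulr_gt0 ?expR_gt0// lnM ?posrE ?expR_gt0// expRK.
  by ring.
have -> : p * s + eps * (p * ln (p / w)) = - (eps * (p * (1 + ln (q / p)))).
  by rewrite lnq; field; rewrite gt_eqF.
have [le_pq eq_pq] := ln_tangent_leif p0 q0; split.
  by rewrite lerN2 ler_pM2l.
by rewrite eqr_opp (inj_eq (mulfI (lt0r_neq0 e0))) eq_sym eq_pq.
Qed.

Section Entropic.
Context {n m : nat}.
Variables (eps : R) (a : 'rV[R]_n) (b : 'rV[R]_m).
Hypotheses (eps0 : 0 < eps) (a0 : forall i, 0 < a 0 i) (b0 : forall j, 0 < b 0 j).
Implicit Types (f : 'rV[R]_n) (g : 'rV[R]_m) (C pi : 'M[R]_(n, m)).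

Lemma gibbs_plan_gt0 f g C i j : 0 < gibbs_plan eps a f b g C i j.
Proof. by rewrite mxE !mulr_gt0// expR_gt0. Qed.

Lemma entropic_lagrangian_leif f g C pi : mx_nonneg pi ->
  gibbs_value eps a f b g C <= entropic_lagrangian eps a b C pi f g
    ?= iff (pi == gibbs_plan eps a f b g C).
Proof.
move=> pi0; rewrite entropic_lagrangianE /gibbs_value.
set A := \sum_i f 0 i * _; set B := \sum_j g 0 j * _; set P := gibbs_plan _ _ _ _ _ _.
set S := \sum_i _; set T := \sum_i _.
have [le_ST eq_ST] : - (eps * S) <= T ?= iff [forall i, [forall j, pi i j == P i j]].
  rewrite /S mulr_sumr -sumrN; apply: leif_sum => i _.
  rewrite mulr_sumr -sumrN; apply: leif_sum => j _.
  by rewrite mxE; apply: gibbs_pointwise_leif; rewrite ?mulr_gt0.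
split; first by lra.
have -> : (- A - B - eps * S == T - A - B) = (- (eps * S) == T).
  by apply/eqP/eqP; lra.
rewrite eq_ST; apply/'forall_forallP/eqP => [E|-> i j]; last exact: eqxx.
by apply/matrixP => i j; apply/eqP.
Qed.

(** The infimum is attained at the Gibbs plan, whose entries are positive. It is therefore always
    finite, and dual optimality becomes an inequality between real numbers. *)
Lemma entropic_dual_funE f g C :
  entropic_dual_fun eps a b C f g = (gibbs_value eps a f b g C)%:E.
Proof.
apply/eqP; rewrite eq_le; apply/andP; split.
  have P0 : mx_nonneg (gibbs_plan eps a f b g C).
    by move=> i j; apply/ltW/gibbs_plan_gt0.
  apply: ereal_inf_lbound; exists (gibbs_plan eps a f b g C) => //.
  by rewrite (eqTleif (entropic_lagrangian_leif f g C P0) (eqxx _)).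
apply: le_ereal_inf_tmp => _ [pi pi0 <-].
by rewrite lee_fin (entropic_lagrangian_leif f g C pi0).
Qed.

(* Replacing [f i] by [f i + eps * ln (r i / a i)], where [r] is the vector of
   row sums of the Gibbs plan, restores the first marginal (a Sinkhorn step)
   and increases the dual value unless [r = a]. *)
Lemma gibbs_plan_row_sum f g C : (0 < m)%N ->
  (forall f', gibbs_value eps a f' b g C <= gibbs_value eps a f b g C) ->
  forall i, \sum_j gibbs_plan eps a f b g C i j = a 0 i.
Proof.
move=> m0 opt; pose r i := \sum_j gibbs_plan eps a f b g C i j.
have r0 i : 0 < r i.
  rewrite /r (bigD1 (Ordinal m0))//= ltr_wpDr ?gibbs_plan_gt0// sumr_ge0// => j _.
  exact/ltW/gibbs_plan_gt0.
pose f' : 'rV[R]_n := \row_i (f 0 i + eps * ln (r i / a 0 i)).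
have P' i : \sum_j gibbs_plan eps a f' b g C i j = a 0 i.
  have -> : a 0 i = (\sum_j gibbs_plan eps a f b g C i j) * (a 0 i / r i).
    by rewrite -/(r i) mulrCA mulfV ?mulr1 ?lt0r_neq0.
  rewrite mulr_suml; apply: eq_bigr => j _; rewrite !mxE -[RHS]mulrA; congr (_ * _).
  have -> : - (C i j + (f 0 i + eps * ln (r i / a 0 i)) + g 0 j) / eps - 1 =
      (- (C i j + f 0 i + g 0 j) / eps - 1) - ln (r i / a 0 i).
    by field; rewrite lt0r_neq0.
  by rewrite expRD expRN lnK ?invf_div// posrE divr_gt0.
have [le_ar eq_ar] : \sum_i a 0 i * (1 + ln (r i / a 0 i)) <= \sum_i r i
    ?= iff [forall i, a 0 i == r i].
  by apply: leif_sum => i _; apply: ln_tangent_leif.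
suff : [forall i, a 0 i == r i] by move=> /forallP h i; apply/esym/eqP/h.
(* Passing from [f] to [f'] raises the dual value by [eps] times the gap in [le_ar]. Optimality of
   [f] makes this gain nonpositive, so the gap closes. *)
rewrite -eq_ar eq_le le_ar -(ler_pM2l eps0)/=.
have := opt f'; rewrite /gibbs_value (eq_bigr _ (fun i _ => P' i)) -/(r _).
have -> : \sum_i f' 0 i * a 0 i =
    \sum_i f 0 i * a 0 i + eps * (\sum_i a 0 i * (1 + ln (r i / a 0 i)) - \sum_i a 0 i).
  rewrite -sumrB mulr_sumr -big_split; apply: eq_bigr => i _ /=; rewrite mxE; ring.
rewrite mulrBr; lra.
Qed.

End Entropic.

(** Exchanging the two measures transposes the plan and preserves the dual value, so the result on
    row sums also covers column sums. *)
Lemma gibbs_plan_tr n m eps (a f : 'rV[R]_n) (b g : 'rV[R]_m) (C : 'M[R]_(n, m)) :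
  gibbs_plan eps b g a f C^T = (gibbs_plan eps a f b g C)^T.
Proof.
by apply/matrixP => j i; rewrite !mxE [b 0 j * _]mulrC [C i j + _ + _]addrAC.
Qed.

Lemma gibbs_value_tr n m eps (a f : 'rV[R]_n) (b g : 'rV[R]_m) (C : 'M[R]_(n, m)) :
  gibbs_value eps b g a f C^T = gibbs_value eps a f b g C.
Proof.
rewrite /gibbs_value gibbs_plan_tr exchange_big /= [X in X - _]addrC.
by congr (_ - _ * _); apply: eq_bigr => i _; apply: eq_bigr => j _; rewrite mxE.
Qed.

Lemma entropic_planE n m eps (a f : 'rV[R]_n) (b g : 'rV[R]_m)
    (C pi : 'M[R]_(n, m)) :
  0 < eps -> (forall i, 0 < a 0 i) -> (forall j, 0 < b 0 j) ->
  (0 < n)%N -> (0 < m)%N ->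
  entropic_plan eps a b C pi -> entropic_dual_optimal eps a b C f g ->
  pi = gibbs_plan eps a f b g C.
Proof.
move=> e0 a0 b0 n0 m0 [pi_c pi_opt] opt.
have {}opt f' g' : gibbs_value eps a f' b g' C <= gibbs_value eps a f b g C.
  by have := opt f' g'; rewrite !entropic_dual_funE// lee_fin.
set P := gibbs_plan _ _ _ _ _ _.
have P0 : mx_nonneg P by move=> i j; apply/ltW/gibbs_plan_gt0.
have P_c : couplings a b P.
  split=> [//||j]; first exact: gibbs_plan_row_sum.
  rewrite -(gibbs_plan_row_sum (f := g) (g := f) (C := C^T) e0 b0 a0 n0)//.
    by rewrite gibbs_plan_tr; apply: eq_bigr => i _; rewrite [RHS]mxE.
  by move=> g'; rewrite !gibbs_value_tr.
have L0 := @entropic_lagrangian_leif n m eps a b e0 a0 b0 f g C.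
have pi0 : mx_nonneg pi by case: pi_c.
(* On couplings the multiplier terms vanish. As the Gibbs plan is itself a coupling, the optimal
   [pi] also attains the minimum of the Lagrangian, and the equality case identifies the two. *)
have costE p : couplings a b p ->
    entropic_cost eps a b C p = entropic_lagrangian eps a b C p f g.
  by move=> /marginal_terms_coupling pE; rewrite /entropic_lagrangian pE addr0.
apply/eqP; rewrite -(L0 _ pi0) eq_le (L0 _ pi0) (eqTleif (L0 _ P0) (eqxx _)).
by rewrite -!costE// pi_opt.
Qed.

End Duality.

(** The terms with index outside [{i, k}] cancel, leaving the factor [1 + 1 / (n - 1)]. *)
Lemma calibrated_gradB (R : realType) (n : nat) (f : 'rV[R]_n) (i k : 'I_n) :
  (2 <= n)%N -> i != k ->
  calibrated_grad f i - calibrated_grad f k =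
  n%:R / (n%:R - 1) * (f 0 i - f 0 k).
Proof.
move=> n2 ik; rewrite /calibrated_grad.
have n1 : n%:R - 1 != 0 :> R by rewrite subr_eq0 pnatr_eq1 gtn_eqF.
rewrite (bigD1 k) 1?eq_sym//= [X in _ - (_ - X)](bigD1 i)//=.
under [X in _ - (_ - (_ + X))]eq_bigl do rewrite andbC.
by field.
Qed.

Theorem theorem2 (R : realType) (X : metricType R) (Y : finType)
    (N N' : nat) (hN : (2 <= N)%N)
    (zt : 'I_N -> X * Y) (zv : 'I_N' -> X * Y)
    (c : R) (hc : 0 < c) (eps : R) (heps : 0 < eps)
    (hs : 'M[R]_(N, N')) (fs : 'rV[R]_N) (gs : 'rV[R]_N')
    (pie : 'M[R]_(N, N')) (fe : 'rV[R]_N) (ge : 'rV[R]_N')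
    (hdual : dual_optimal (empirical_mass N) (empirical_mass N')
               (feature_label_cost c zt zv) hs fs gs)
    (hplan : entropic_plan eps (empirical_mass N) (empirical_mass N')
               (feature_label_cost c zt zv) pie)
    (hedual : entropic_dual_optimal eps (empirical_mass N) (empirical_mass N')
                (feature_label_cost c zt zv) fe ge)
    (i k : 'I_N) (hik : i != k) (j : 'I_N') :
  calibrated_grad fs i - calibrated_grad fs k =
  calibrated_grad fe i - calibrated_grad fe k
  + eps * (N%:R / (N%:R - 1))
    * (ln ((pie i j / (empirical_mass N : 'rV[R]_N) 0 i)
           / (pie k j / (empirical_mass N : 'rV[R]_N) 0 k))
       + (hs k j - hs i j) / eps).
Proof.
have N0 : (0 < N)%N := ltnW hN.
have N'0 : (0 < N')%N := leq_ltn_trans (leq0n j) (ltn_ord j).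
have mass_gt0 p (l : 'I_p) : (0 < p)%N -> 0 < (empirical_mass p : 'rV[R]_p) 0 l.
  by move=> p0; rewrite mxE invr_gt0 ltr0n.
move: hdual hplan hedual; set a := empirical_mass N; set b := empirical_mass N'.
set C := feature_label_cost _ _ _ => hdual hplan hedual.
have a0 l : 0 < a 0 l by exact: mass_gt0.
have b0 l : 0 < b 0 l by exact: mass_gt0.
have pieE := entropic_planE heps a0 b0 N0 N'0 hplan hedual.
(* Dividing by [a 0 l] confines the dependence on [l] to [C l j + fe 0 l], so [b 0 j] and [ge 0 j]
   drop out of the difference between [i] and [k]. *)
have ln_plan l : ln (pie l j / a 0 l) =
    ln (b 0 j) - (C l j + fe 0 l + ge 0 j) / eps - 1.
  have -> : pie l j / a 0 l = b 0 j * expR (- (C l j + fe 0 l + ge 0 j) / eps - 1).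
    by rewrite pieE mxE mulrAC [a 0 l * _]mulrC mulfK ?lt0r_neq0.
  by rewrite lnM ?posrE ?expR_gt0// expRK addrA mulNr.
have quot_gt0 l : pie l j / a 0 l \is Num.pos.
  by rewrite posrE divr_gt0// pieE gibbs_plan_gt0.
rewrite ln_div// !ln_plan !calibrated_gradB//.
(* Using the same column [j] for both rows eliminates [gs 0 j]. *)
have := dual_optimal_stationary hdual i j.
have := dual_optimal_stationary hdual k j.
move=> /eqP; rewrite addrAC addr_eq0 => /eqP fk /eqP.
rewrite addrAC addr_eq0 => /eqP fi.
have {fi fk} -> : fs 0 i - fs 0 k = C k j - C i j + hs k j - hs i j.
  lra.
have N1 : N%:R - 1 != 0 :> R by rewrite subr_eq0 pnatr_eq1 gtn_eqF.
by field; rewrite N1 gt_eqF.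
Qed.
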